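(* Let $G$ be a hyperbolic group, let $U\subseteq G$ be a finite union of quasiconvex products in $G$, and let the subgroups $H_1,H_2,\dots,H_s$ ($s\ge 1$) be all the members of $U$. If $K$ is a subgroup of $G$ and $K\subseteq U$, then for some $g\in G$ and some $j\in\{1,2,\dots,s\}$ one has $|K:(K\cap H_j^g)|<\infty$.
   Context: A finitely generated group $G$ is hyperbolic if its Cayley graph $\Gamma(G,\mathcal{A})$ with respect to some (equivalently, any) finite symmetrized generating set $\mathcal{A}=\mathcal{A}^{-1}$ is a Gromov hyperbolic metric space. A subset $Q\subseteq G$ is $\varepsilon$-quasiconvex ($\varepsilon\ge 0$) if every geodesic in $\Gamma(G,\mathcal{A})$ connecting two elements of $Q$ lies in the closed $\varepsilon$-neighborhood of $Q$; $Q$ is quasiconvex if it is $\varepsilon$-quasiconvex for some $\varepsilon$ (for hyperbolic $G$ this does not depend on the choice of the finite generating set). A quasiconvex product is a set of the form $P=f_0G_1f_1G_2\cdots f_{n-1}G_nf_n=\{f_0g_1f_1\cdots g_nf_n\mid g_i\in G_i,\ i=1,\dots,n\}$, where $n\in\mathbb{N}\cup\{0\}$, $G_1,\dots,G_n$ are quasiconvex subgroups of $G$ and $f_0,\dots,f_n\in G$; the subgroups $G_1,\dots,G_n$ are the members of $P$. A finite union of quasiconvex products is a set $U=\bigcup_{k=1}^q P_k$ with each $P_k$ a quasiconvex product; a fixed such representation is part of the data, and a subgroup is a member of $U$ if it is a member of some $P_k$. For $g\in G$ and $H\le G$, $H^g=gHg^{-1}$. *)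

(* Defs.v *)
(* MathComp: groupType for (possibly infinite) groups, classical sets,
   and an arbitrary realType for distances. *)
From HB Require Import structures.
From mathcomp Require Import all_boot all_order all_algebra.
From mathcomp Require Import all_classical reals.

Set Implicit Arguments.
Unset Strict Implicit.
Unset Printing Implicit Defensive.

Import Order.TTheory GRing.Theory Num.Theory.
Local Open Scope classical_set_scope.
Local Open Scope ring_scope.

(* The notions in this first part are stated for a pseudometric d : points at
   distance 0 are to be identified. *)

Definition gromov_product (R : realType) (X : Type) (d : X -> X -> R)
    (x y w : X) : R := (d x w + d y w - d x y) / 2.

Definition gromov_hyperbolic (R : realType) (X : Type) (d : X -> X -> R) :
    Prop :=
  exists delta : R, 0 <= delta /\ forall x y z w : X,
    Num.min (gromov_product d x z w) (gromov_product d z y w) - delta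
      <= gromov_product d x y w.

Definition is_geodesic (R : realType) (X : Type) (d : X -> X -> R)
    (x y : X) (L : R) (p : R -> X) : Prop :=
  [/\ 0 <= L, d (p 0) x = 0, d (p L) y = 0 &
      forall s t, 0 <= s <= L -> 0 <= t <= L -> d (p s) (p t) = `|s - t|].

(* The geometric realization of a loopless graph with symmetric adjacency
   relation E, every edge being a segment of length 1.  [EdgePt e t], with
   [e : E x y], is the point of the edge {x, y} at distance t from x and 1 - t
   from y; it is the same point as [EdgePt e' (1 - t)] for [e' : E y x], and
   for t = 0 (t = 1) it is the vertex x (y): these points are at distance 0. *)
Inductive graph_point (R : realType) (V : Type) (E : V -> V -> Prop) : Type :=
| Vertex of V
| EdgePt (x y : V) (e : E x y) (t : R) (ht : 0 <= t <= 1).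

Arguments Vertex R {V} E _.

Inductive walk (V : Type) (E : V -> V -> Prop) : nat -> V -> V -> Prop :=
| walk_nil x : walk E 0 x x
| walk_cons n x y z : E x y -> walk E n y z -> walk E n.+1 x z.

(* r is the length of the segment from p to the vertex v inside a closed edge
   containing p (inside {v} when p is given as a vertex). *)
Definition end_segment (R : realType) (V : Type) (E : V -> V -> Prop)
    (p : graph_point R E) (v : V) (r : R) : Prop :=
  match p with
  | Vertex x => v = x /\ r = 0
  | EdgePt x y _ t _ => (v = x /\ r = t) \/ (v = y /\ r = 1 - t)
  end.

(* l is the length of the segment from p to q inside a common edge. *)
Definition edge_segment (R : realType) (V : Type) (E : V -> V -> Prop)
    (p q : graph_point R E) (l : R) : Prop :=
  match p, q with
  | EdgePt x y _ s _, EdgePt x' y' _ t _ =>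
      [/\ x' = x, y' = y & l = `|s - t|] \/
      [/\ x' = y, y' = x & l = `|s - (1 - t)|]
  | _, _ => False
  end.

Definition path_length (R : realType) (V : Type) (E : V -> V -> Prop)
    (p q : graph_point R E) (l : R) : Prop :=
  edge_segment p q l \/
  exists (v w : V) (r s : R) (n : nat),
    [/\ end_segment p v r, end_segment q w s, walk E n v w & l = r + n%:R + s].

(* The path metric; it is meaningful for connected graphs only, as [inf] of the
   empty set is 0. *)
Definition graph_dist (R : realType) (V : Type) (E : V -> V -> Prop)
    (p q : graph_point R E) : R := inf [set l | path_length p q l].

Definition subgroup (G : groupType) (H : set G) : Prop := group_closed (mem H).

Definition generates (G : groupType) (A : set G) : Prop :=
  forall H : set G, subgroup H -> A `<=` H -> H = [set: G].

Definition finite_symmetric_generating (G : groupType) (A : set G) : Prop :=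
  [/\ finite_set A, [set (a^-1)%g | a in A] = A & generates A].

(* If the identity is in A, the loops it would give are left out: they affect
   neither geodesics between vertices nor hyperbolicity. *)
Definition cayley_edge (G : groupType) (A : set G) (g h : G) : Prop :=
  g <> h /\ A (g^-1 * h)%g.

Definition cayley_dist (R : realType) (G : groupType) (A : set G) :
    graph_point R (cayley_edge A) -> graph_point R (cayley_edge A) -> R :=
  @graph_dist R G (cayley_edge A).

Definition hyperbolic_wrt (R : realType) (G : groupType) (A : set G) : Prop :=
  finite_symmetric_generating A /\ gromov_hyperbolic (@cayley_dist R G A).

(* Distances from a point to vertices take finitely many values below any given
   bound, so the distance to a nonempty Q is attained and its closed
   eps-neighborhood is the set of points at distance at most eps from some
   element of Q. *)
Definition eps_quasiconvex (R : realType) (G : groupType) (A : set G)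
    (eps : R) (Q : set G) : Prop :=
  forall (x y : G) (L : R) (p : R -> graph_point R (cayley_edge A)),
    Q x -> Q y ->
    is_geodesic (@cayley_dist R G A) (Vertex R _ x) (Vertex R _ y) L p ->
    forall t, 0 <= t <= L ->
      exists2 z, Q z & cayley_dist (p t) (Vertex R _ z) <= eps.

Definition quasiconvex (R : realType) (G : groupType) (A : set G)
    (Q : set G) : Prop :=
  exists2 eps : R, 0 <= eps & eps_quasiconvex A eps Q.

(* The data f_0, G_1, f_1, ..., G_n, f_n; [factor P i] is G_(i+1). *)
Record product_data (G : groupType) := ProductData {
  nfactors : nat;
  factor : 'I_nfactors -> set G;
  coef : 'I_nfactors.+1 -> G
}.

Arguments factor {G} p _.
Arguments coef {G} p _.

Definition product_set (G : groupType) (P : product_data G) : set G :=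
  [set (coef P ord0 * \prod_(i < nfactors P) (g i * coef P (lift ord0 i)))%g
    | g in [set g : 'I_(nfactors P) -> G | forall i, factor P i (g i)]].

Definition quasiconvex_product (R : realType) (G : groupType) (A : set G)
    (P : product_data G) : Prop :=
  forall i, subgroup (factor P i) /\ quasiconvex R A (factor P i).

Definition members (G : groupType) (P : product_data G) : set (set G) :=
  range (factor P).

Definition conjugate (G : groupType) (H : set G) (g : G) : set G :=
  [set (g * h * g^-1)%g | h in H].

(* |K : L| < oo, for a subgroup L of K. *)
Definition finite_index (G : groupType) (K L : set G) : Prop :=
  finite_set [set [set (x * l)%g | l in L] | x in K].

(* Main.v *)
Require Import Defs.
From mathcomp Require Import all_boot all_order all_algebra.
From mathcomp Require Import all_classical reals.
From mathcomp Require Import finmap zify ring lra.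
Set Implicit Arguments.
Unset Strict Implicit.
Unset Printing Implicit Defensive.
Import Order.TTheory GRing.Theory Num.Theory.
Local Open Scope classical_set_scope.

(** The argument is by contradiction and takes place in [G] with its word
metric [d], [len g] being the distance from the identity to [g].  Suppose that
no subgroup [K `&` conjugate (H j) g] has finite index in [K].

By B. H. Neumann's lemma ([neumann]), [K] is not covered by finitely many cosets
of conjugates of the [H j].  So for each [C] there are elements of [K] that are
not of the form [b h b'] with [h] in some [H j] and [len b, len b' <= C]; call
them C-escaping.  A segment from [g] to [g z], with [z] escaping, does not have
both its ends near one coset of an [H j].

The key fact ([escaping_direction]) is that escaping elements do not all point
in the same direction: there is a constant [c] such that for every [u] in [K]
and every [C], some C-escaping [z] has a Gromov product with [u] at most [c].
Otherwise the escaping elements, together with their inverses and translates by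
elements of [K], would all converge to a single point of the boundary, which [K]
would fix ([no_attracting_point]).  Let [beta] be the Busemann function of this
point, a quasimorphism on [K].  An element [w] of [K] moves the points [p] far
along a ray towards the fixed point by about [|beta w|] at most, and [w |-> p^-1 w p] is
injective into a ball of [G]: so [beta] is proper on [K].  Multiplying by powers
of one element with large [beta] then gives [len z <= |beta z| + E] on [K], with
[E] constant.  But an escaping [z] and its inverse both have a large Gromov
product with the fixed point, which makes [len z - |beta z|] large.

Now [K] contains, for all [n] and [C], an element that is not a product of an
element of length at most [C] and of [n] factors of the form [h b], with [h] in
some [H j] and [len b <= C] ([not_sub_products]).  Indeed, given such an element
[k] for [n] and a larger constant, choose [z] escaping with a bounded Gromov
product with [k^-1]: then [k] is near a geodesic from [1] to [k z].  Were [k z]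
a product of [n.+1] factors, this geodesic would follow the broken line through
the partial products, each side of which stays near a coset of some [H j] by
quasiconvexity.  The element [k] cannot be near the first [n] sides, since it
would then be a product of [n] factors; and it cannot be near the last one,
since [k] and [k z] would be near the same coset ([close_to_last_factor]).

As [U] is contained in one of these sets of products, this is a contradiction.
Hyperbolicity and quasiconvexity are only used through their consequences on the
vertices of the Cayley graph: the four-point inequality for the word metric
([word_length_hyperbolic]), and the quasiconvexity of the members for vertices
on a geodesic ([quasiconvex_vertices]). *)

(** * Hyperbolic length functions *)

(** The left-invariant distance given by a length function. *)
Definition dist (G : groupType) (len : G -> nat) (x y : G) : nat :=
  len (x^-1 * y)%g.

(** An integer-valued length on a group, with finite balls, whose distance is
discretely geodesic and satisfies the four-point form of hyperbolicity: of the
three sums of distances between opposite points of a quadruple, the two largest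
differ by at most [D]. *)
Record hyperbolic_length (G : groupType) (len : G -> nat) (D : nat) : Prop := {
  len1 : len 1%g = 0;
  lenV : forall x, len x^-1%g = len x;
  lenM : forall x y, (len (x * y)%g <= len x + len y)%N;
  len_prefix : forall x n, (n <= len x)%N ->
    exists2 y, len y = n & dist len y x = (len x - n)%N;
  len_ball : forall n, finite_set [set x | (len x <= n)%N];
  dist_4pt : forall x y z w, (dist len x y + dist len z w <=
    maxn (dist len x z + dist len y w) (dist len x w + dist len y z) + D)%N
}.

Section LengthBasics.
Variables (G : groupType) (len : G -> nat) (D : nat).
Hypothesis hL : hyperbolic_length len D.
Local Notation d := (dist len).

Lemma dist1 x : d 1%g x = len x.
Proof. by rewrite /dist invg1 mul1g. Qed.

Lemma distC x y : d x y = d y x.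
Proof. by rewrite /dist -(lenV hL) invgM invgK. Qed.

Lemma distr1 x : d x 1%g = len x.
Proof. by rewrite distC dist1. Qed.

Lemma distxx x : d x x = 0%N.
Proof. by rewrite /dist mulVg (len1 hL). Qed.

Lemma distMl g x y : d (g * x)%g (g * y)%g = d x y.
Proof. by rewrite /dist invgM -mulgA mulKg. Qed.

Lemma dist_triangle y x z : (d x z <= d x y + d y z)%N.
Proof.
rewrite /dist; have -> : (x^-1 * z = (x^-1 * y) * (y^-1 * z))%g
  by rewrite -mulgA mulVKg.
exact: (lenM hL).
Qed.

End LengthBasics.

(** * Subgroups do not converge to a single boundary point *)

(** The twofold Gromov product of [x] and [y] at the identity is
[len x + len y - d x y]; it is bounded below by writing
[c + d x y <= len x + len y]. *)
Section NoAttractingPoint.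
Variables (G : groupType) (len : G -> nat) (D : nat).
Hypothesis hL : hyperbolic_length len D.
Local Notation d := (dist len).
Variables (K : set G) (S : nat -> set G).
Hypotheses (KM : forall x y, K x -> K y -> K (x * y)%g)
  (KV : forall x, K x -> K x^-1%g).
(** Neighborhoods [S n], decreasing with [n], of infinity in [K]; by [S_close]
their elements converge to a single point at infinity. *)
Hypotheses (S_anti : forall m n, (m <= n)%N -> S n `<=` S m)
  (S_neq0 : forall n, exists z, S n z)
  (SK : forall n, S n `<=` K)
  (SV : forall n z, S n z -> S n z^-1%g)
  (SM : forall n w z, K w -> S (n + len w)%N z -> S n (w * z)%g)
  (S_close : forall c, exists n, forall z z', S n z -> S n z' ->
     (c + d z z' <= len z + len z')%N).

(** [phi] holds near the point at infinity. *)
Let evt (phi : G -> Prop) := exists n, forall z, S n z -> phi z.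

Let evtI phi psi : evt phi -> evt psi -> evt (fun z => phi z /\ psi z).
Proof.
move=> [m Hm] [n Hn]; exists (maxn m n) => z Sz; split.
  by apply: Hm; apply: S_anti Sz; rewrite leq_maxl.
by apply: Hn; apply: S_anti Sz; rewrite leq_maxr.
Qed.

Let evtP (phi : G -> Prop) (P : Prop) : evt phi -> (forall z, phi z -> P) -> P.
Proof. by move=> [n Hn] H; have [z /Hn/H] := S_neq0 n. Qed.

Let evtM w phi : K w -> evt phi -> evt (fun z => phi (w * z)%g).
Proof. by move=> Kw [n Hn]; exists (n + len w)%N => z /(SM Kw)/Hn. Qed.

(** [b] is, up to [D], the difference of the distances from [1] and from [a] to
[z]. *)
Let busemann_at a b z :=
  (b - D%:Z <= (len z)%:Z - (d a z)%:Z)%R /\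
  ((len z)%:Z - (d a z)%:Z <= b + D%:Z)%R.

Let busemann_exists a : exists b : int, evt (busemann_at a b).
Proof.
have [n Hn] := S_close (2 * len a + D + 1).
have [z0 S0] := S_neq0 n; exists ((len z0)%:Z - (d a z0)%:Z)%R.
exists n => z Sz.
have H1 := dist_4pt hL a z0 1%g z; have H2 := dist_4pt hL a z 1%g z0.
have H3 := Hn _ _ S0 Sz.
have H4 := dist_triangle hL a 1%g z; have H5 := dist_triangle hL a 1%g z0.
rewrite /busemann_at.
rewrite !(dist1, distr1 hL) (distC hL z z0) in H1 H2 H3 H4 H5 *.
lia.
Qed.

(** The Busemann function of the point at infinity, defined up to an additive
error [D]; it increases towards that point. *)
Let beta : G -> int := fun a => projT1 (cid (busemann_exists a)).
Let betaP a : evt (busemann_at a (beta a)).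
Proof. by rewrite /beta; case: (cid _). Qed.

Let beta_le a : (beta a <= (len a)%:Z + D%:Z)%R /\
  (- (len a)%:Z - D%:Z <= beta a)%R.
Proof.
apply: (evtP (betaP a)) => z [].
move: (dist_triangle hL a 1%g z) (dist_triangle hL 1%g a z).
rewrite !(dist1, distr1 hL); lia.
Qed.

Let betaM w a : K w -> (beta w + beta a - 3%:Z * D%:Z <= beta (w * a)%g)%R /\
  (beta (w * a)%g <= beta w + beta a + 3%:Z * D%:Z)%R.
Proof.
move=> Kw; have KwV := KV Kw.
apply: (evtP (evtI (betaP w) (evtI (betaP (w * a)%g) (evtM KwV (betaP a))))).
move=> z [] + []; rewrite /busemann_at /= -(distMl _ w a) mulVKg.
rewrite -[len (w^-1 * z)%g]/(d w z); lia.
Qed.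

(** Points of a ray to the point at infinity. *)
Let far_point T : exists p, len p = T /\ (T%:Z - 2%:Z * D%:Z <= beta p)%R.
Proof.
have [n Hn] := S_close (2 * T + D + 1).
have [z Sz] := S_neq0 n.
have zT : (T <= len z)%N by have := Hn _ _ Sz Sz; rewrite (distxx hL); lia.
have [p pT pz] := len_prefix hL zT; exists p; split=> //.
apply: (evtP (evtI (betaP p) (ex_intro _ n (fun z => id)))) => z' [[]] + + Sz'.
have := Hn _ _ Sz Sz'; have := dist_4pt hL p z' 1%g z.
have := dist_triangle hL 1%g p z'.
rewrite !(dist1, distr1 hL) pz pT (distC hL z' z); lia.
Qed.

(** Far along a ray to the point at infinity, [w] acts almost as a translation
of the ray. *)
Let displacement w p : K w -> (2 * len w + 10 * D <= 2 * len p)%N ->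
  ((len p)%:Z - 2%:Z * D%:Z <= beta p)%R ->
  ((d p (w * p)%g)%:Z <= `|beta w| + 7%:Z * D%:Z)%R.
Proof.
move=> Kw pw bp; have [b1 b2] := betaM p Kw; have [b3 b4] := beta_le w.
apply: (evtP (evtI (betaP w) (evtI (betaP p) (betaP (w * p)%g)))) => z.
rewrite /busemann_at.
have := dist_4pt hL p (w * p)%g 1%g z; have := dist_4pt hL 1%g (w * p)%g w z.
have := distMl len w 1%g p; rewrite mulg1 (distC hL (w * p)%g w) => ->.
rewrite !(dist1, distr1 hL); lia.
Qed.

(** [beta] is proper on [K]. *)
Let level_bounded B : exists E,
  forall w, K w -> (`|beta w| <= B%:Z)%R -> (len w <= E)%N.
Proof.
pose W := [set w | K w /\ (`|beta w| <= B%:Z)%R].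
suff /finite_fsetP[F WF] : finite_set W.
  exists (\max_(w <- F) len w) => w Kw bw; apply: leq_bigmax_seq => //.
  by have : [set` F] w by rewrite -WF.
apply: contrapT => Winf.
have [F0 eF0] := finite_fsetP.1 (len_ball hL (B + 7 * D)).
have [F FW cF] := infinite_set_fset #|` F0|.+1 Winf.
pose T := (\max_(w <- F) len w + 5 * D)%N.
have [p [pT bp]] := far_point T.
(* Conjugation by [p], far enough for all of [F], maps [F] into a ball whose
   cardinality does not depend on [F]. *)
have : {subset [fset (p^-1 * w * p)%g | w in F]%fset <= F0}.
  move=> _ /imfsetP[w /= Fw ->].
  have [Kw bw] := FW _ Fw.
  have wT : (len w <= \max_(w <- F) len w)%N by apply: leq_bigmax_seq.
  have : [set x | (len x <= B + 7 * D)%N] (p^-1 * w * p)%g.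
    rewrite /= -mulgA -[len _]/(d p (w * p)%g).
    have : ((d p (w * p)%g)%:Z <= `|beta w| + 7%:Z * D%:Z)%R.
      by apply: displacement; rewrite ?pT ?/T //; lia.
    lia.
  by rewrite eF0.
move=> /fsubsetP/fsubset_leq_card; rewrite card_imfset /=; last first.
  by move=> x y /mulIg/mulgI.
by rewrite leqNgt cF.
Qed.

Let betaV z : K z -> (- beta z - 4%:Z * D%:Z <= beta z^-1%g)%R /\
  (beta z^-1%g <= - beta z + 4%:Z * D%:Z)%R.
Proof.
move=> Kz; have := betaM z^-1%g Kz; have := beta_le 1%g.
rewrite mulgV (len1 hL); lia.
Qed.

(** [len z - beta z] is, up to a multiple of [D], twice the Gromov product of
[z^-1] with the point at infinity; the four-point inequality keeps it from accumulating errors when [x]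
is multiplied on the right by an element [y] with [beta y] large compared with [D]. *)
Let excess x y : K x -> K y ->
  ((len (x * y)%g)%:Z - beta (x * y)%g <=
   Num.max ((len x)%:Z - beta x - 2%:Z * beta y + 12%:Z * D%:Z)
     ((len y)%:Z - beta y + 8%:Z * D%:Z))%R.
Proof.
move=> Kx Ky; have := betaM y Kx.
apply: (evtP (evtI (betaP x) (betaP (x * y)%g))) => z.
rewrite /busemann_at.
have := dist_4pt hL 1%g (x * y)%g x z; have := distMl len x 1%g y.
rewrite mulg1 (distC hL (x * y)%g x) => ->.
rewrite !(dist1, distr1 hL); lia.
Qed.

(** The elements of [K] with [beta] large are obtained from a bounded set by
successive multiplication by a fixed [z0]. *)
Let almost_radial : exists E,
  forall z, K z -> ((len z)%:Z <= `|beta z| + E%:Z)%R.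
Proof.
have [[z0 [Kz0 b0]]|noz] :=
  pselect (exists z, K z /\ (10%:Z * D%:Z + 1 <= beta z)%R); last first.
  have [E HE] := level_bounded (20 * D + 10); exists E => z Kz.
  have : (beta z < 10%:Z * D%:Z + 1)%R.
    by rewrite ltNge; apply/negP => ?; apply: noz; exists z.
  have : (beta z^-1%g < 10%:Z * D%:Z + 1)%R.
    by rewrite ltNge; apply/negP => ?; apply: noz;
       exists z^-1%g; split=> //; apply: KV.
  have := betaV Kz; have := HE z Kz; lia.
pose B := `|(beta z0 + 3%:Z * D%:Z)%R|%N.
have [E HE] := level_bounded B.
pose E' := (E + B + len z0 + 10 * D)%N.
suff main n z : K z -> (- B%:Z <= beta z)%R -> (beta z <= n%:Z)%R ->
    ((len z)%:Z - beta z <= E'%:Z)%R.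
  exists (E' + 4 * D)%N => z Kz.
  have bV := betaV Kz; have := main `|beta z|%N z Kz.
  have := main `|beta z^-1%g|%N z^-1%g (KV Kz); rewrite (lenV hL).
  lia.
elim: n z => [|n IH] z Kz zB zn; have Ez := HE z Kz; first lia.
have [|bz] := lerP (beta z) B%:Z; first lia.
have Kx : K (z * z0^-1)%g by apply: KM => //; apply: KV.
have := excess Kx Kz0; have := betaM z0 Kx; have := IH _ Kx.
rewrite mulgVK; have := beta_le z0; lia.
Qed.

(** No family of neighborhoods of infinity in a subgroup [K], stable under
inversion and under translation by [K], converges to a single point. *)
Lemma no_attracting_point : False.
Proof.
have [E HE] := almost_radial.
have [n Hn] := S_close (E + 20 * D + 1).
have [z Sz] := S_neq0 n; have Kz := SK Sz.
apply: (evtP (evtI (evtI (betaP z) (betaP z^-1%g))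
  (ex_intro _ n (fun z => id)))).
move=> z'; rewrite /busemann_at => -[] + Sz'.
have := Hn _ _ Sz Sz'; have := Hn _ _ (SV Sz) Sz'.
have := HE _ Kz; have := betaV Kz; rewrite (lenV hL); lia.
Qed.

End NoAttractingPoint.

(** * Covers by cosets *)

Section Subgroups.
Variables (G : groupType) (H : set G).
Hypothesis hH : subgroup H.

Lemma subgroup1 : H 1%g.
Proof. by case: hH => H1 _; apply: set_mem. Qed.

Lemma subgroupV x : H x -> H x^-1%g.
Proof. by move=> /mem_set Hx; apply/set_mem/(group_closedV hH Hx). Qed.

Lemma subgroupM x y : H x -> H y -> H (x * y)%g.
Proof.
by move=> /mem_set Hx /mem_set Hy; apply/set_mem/(group_closedM hH Hx Hy).
Qed.

Lemma subgroup_conjugate g : subgroup (conjugate H g).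
Proof.
split; first by apply: mem_set; exists 1%g; [exact: subgroup1|rewrite mulg1 mulgV].
move=> x y /set_mem[h Hh <-] /set_mem[h' Hh' <-]; apply: mem_set.
exists (h * h'^-1)%g; first by apply: subgroupM => //; apply: subgroupV.
by rewrite !invgM !invgK -!mulgA mulKg.
Qed.

End Subgroups.

Lemma finite_index_cover (G : groupType) (K L X : set G) :
  subgroup K -> subgroup L -> finite_set X ->
  (forall k, K k -> exists2 x, X x & L (x^-1 * k)%g) ->
  finite_index K (K `&` L).
Proof.
move=> hK hL fX cov; rewrite /finite_index.
pose f x := [set y | K y /\ L (x^-1 * y)%g].
apply: (@sub_finite_set _ _ (f @` X)); last exact: finite_image.
move=> _ [k Kk <-]; have [x Xx Lxk] := cov k Kk; exists x => //.
apply/seteqP; split=> [y [Ky Lxy]|_ [l [Kl Ll] <-]].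
  exists (k^-1 * y)%g; last by rewrite mulVKg.
  split; first by apply: subgroupM => //; apply: subgroupV.
  have -> : (k^-1 * y = (x^-1 * k)^-1 * (x^-1 * y))%g.
    by rewrite invgM invgK -mulgA mulVKg.
  by apply: subgroupM => //; apply: subgroupV.
split; first exact: subgroupM.
by rewrite mulgA; apply: subgroupM.
Qed.

(** B. H. Neumann: if a group is covered by finitely many cosets of subgroups,
then one of these subgroups has finite index.  Here the group is a subgroup [K]
of [G], and the cosets are those of subgroups [L i] of [G]. *)
Lemma neumann (G : groupType) (I : eqType) (K : set G) (L : I -> set G)
    (s : seq I) (X : set G) :
  subgroup K -> (forall i, subgroup (L i)) -> finite_set X ->
  (forall k, K k -> exists i x, [/\ i \in s, X x & L i (x^-1 * k)%g]) ->
  exists2 i, i \in s & finite_index K (K `&` L i).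
Proof.
move=> hK hL; elim: s X => [|i s IH] X fX cov.
  by have [? [? []]] := cov _ (subgroup1 hK).
have [fi|nfi] := pselect (finite_index K (K `&` L i)).
  by exists i => //; rewrite mem_head.
have [k Kk kX] : exists2 k, K k & forall x, X x -> ~ L i (x^-1 * k)%g.
  apply: contrapT => nk; apply: nfi; apply: (finite_index_cover hK (hL i) fX).
  move=> k Kk; apply: contrapT => nx; apply: nk; exists k => // x Xx Lx.
  by apply: nx; exists x.
(* [y x] is an element of [K] in the coset [x (L i)], when there is one. *)
have /choice[y yP] : forall x : G, exists y, forall z,
    K z -> L i (x^-1 * z)%g -> K y /\ L i (x^-1 * y)%g.
  move=> x; have [[y Hy]|ny] := pselect (exists y, K y /\ L i (x^-1 * y)%g).
    by exists y.
  by exists 1%g => z Kz Lz; exfalso; apply: ny; exists z.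
pose X' := X `|` (fun p => (y p.1 * k^-1 * p.2)%g) @` (X `*` X).
have [|g Kg|j sj fj] := IH X'; last by exists j => //; rewrite in_cons sj orbT.
  by rewrite finite_setU; split=> //; apply/finite_image/finite_setX.
(* If [g] is in a coset of [L i], translate this coset to [k (L i)]; as the latter
   is not one of those in the cover, the translate of [g] is in a coset of
   another subgroup. *)
have [j [x [+ Xx Lx]]] := cov g Kg.
rewrite in_cons => /orP[/eqP jE|sj]; last by exists j, x; split=> //; left.
rewrite {}jE in Lx; have [Ky Lyx] := yP x g Kg Lx.
have Lg : L i ((y x)^-1 * g)%g.
  have -> : ((y x)^-1 * g = (x^-1 * y x)^-1 * (x^-1 * g))%g.
    by rewrite invgM invgK -mulgA mulVKg.
  by apply: subgroupM => //; apply: subgroupV.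
have Kkg : K (k * ((y x)^-1 * g))%g.
  by do 2!apply: subgroupM => //; apply: subgroupV.
have [j' [x' [+ Xx' Lx']]] := cov _ Kkg.
rewrite in_cons => /orP[/eqP jE|sj'].
  exfalso; apply: (kX x' Xx').
  have -> : (x'^-1 * k = x'^-1 * (k * ((y x)^-1 * g)) * ((y x)^-1 * g)^-1)%g.
    by rewrite mulgA mulgK.
  by rewrite jE in Lx'; apply: subgroupM => //; apply: subgroupV.
exists j', (y x * k^-1 * x')%g; split=> //; first by right; exists (x, x').
by rewrite !invgM invgK -!mulgA.
Qed.

(** * Products of quasiconvex subgroups *)

Section ProductsOfSubgroups.
Variables (G : groupType) (len : G -> nat) (D : nat).
Hypothesis hL : hyperbolic_length len D.
Local Notation d := (dist len).
Variables (s : nat) (H : 'I_s -> set G) (E : nat).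
Hypothesis hs : (0 < s)%N.
Hypothesis hH : forall i, subgroup (H i).
Hypothesis qcH : forall i x y v, H i x -> H i y ->
  (d x v + d v y = d x y)%N -> exists2 q, H i q & (d v q <= E)%N.

(** Points that are almost on a geodesic between two elements of [H i]. *)
Lemma quasigeodesic_near i x y v r : H i x -> H i y ->
  (d x v + d v y <= d x y + r)%N -> exists2 q, H i q & (d v q <= E + r + D)%N.
Proof.
move=> Hx Hy vr.
have [u uT uy] := len_prefix hL (geq_minr (d x v) (len (x^-1 * y))).
(* The point of a geodesic from [x] to [y] at the same distance from [x] as [v],
   or [y] if the geodesic is too short. *)
pose v' := (x * u)%g.
have v'x : d x v' = minn (d x v) (d x y).
  by rewrite -uT /v' -{1}[x]mulg1 (distMl len x 1%g u) dist1.
have v'y : d v' y = (d x y - minn (d x v) (d x y))%N.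
  rewrite -[d x y]/(len _) -uy -(distMl len x u (x^-1 * y)%g) mulVKg //.
have [q Hq vq] := qcH Hx Hy (v := v') ltac:(lia).
exists q => //; have := dist_triangle hL v' v q; have := dist_4pt hL v v' x y.
rewrite (distC hL v x) (distC hL v' x); lia.
Qed.

(** The products [a h_1 b_1 ... h_n b_n], where each [h_j] is in some [H i] and
[a] and the [b_j] have length at most [C]. *)
Fixpoint products (n C : nat) : set G :=
  if n is n'.+1 then
    [set x | exists t i h b,
       [/\ products n' C t, H i h, (len b <= C)%N & x = (t * h * b)%g]]
  else [set x | (len x <= C)%N].

Lemma products_mono n C C' : (C <= C')%N -> products n C `<=` products n C'.
Proof.
move=> CC'; elim: n => [|n IH] x /=; first by move=> /leq_trans; apply.
move=> [t [i [h [b [/IH ? ? bC ->]]]]]; exists t, i, h, b; split=> //.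
exact: leq_trans CC'.
Qed.

Lemma products_le n m C : (n <= m)%N -> products n C `<=` products m C.
Proof.
move=> /subnK <-; elim: (m - n)%N => [//|k IH] x /IH Px.
exists x, (Ordinal hs), 1%g, 1%g; split=> //; last by rewrite !mulg1.
  exact: subgroup1.
by rewrite (len1 hL).
Qed.

(** If [k] is almost on a geodesic from [1] to [t h b], with [h] in [H i] and [b]
short, then it is almost on one from [1] to [t] or near the coset [t (H i)]. *)
Lemma close_to_last_factor k t i h b C r : H i h -> (len b <= C)%N ->
  (len k + d k (t * h * b)%g <= len (t * h * b)%g + r)%N ->
  (len k + d k t <= len t + (r + D))%N \/
  exists q b',
    [/\ H i q, (len b' <= E + 2 * C + r + 3 * D)%N & k = (t * q * b')%g].
Proof.
move=> Hh bC kr; set x := (t * h * b)%g in kr.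
have [|ktr] := leqP (len k + d k t) (len t + (r + D)); [by left|right].
have [tk|tk] := leqP (d t k + d k (t * h)%g) (d t (t * h)%g + (r + 2 * D)).
  have [|q Hq kq] := @quasigeodesic_near i 1%g h (t^-1 * k)%g (r + 2 * D)
    (subgroup1 (hH i)) Hh.
    by rewrite -(distMl len t 1%g (t^-1 * k)%g) -(distMl len t (t^-1 * k)%g h)
         -(distMl len t 1%g h) mulVKg mulg1.
  exists q, (q^-1 * (t^-1 * k))%g; split=> //; last by rewrite -mulgA !mulVKg.
  by rewrite -[len _]/(d q (t^-1 * k)%g) (distC hL); lia.
exists h, (h^-1 * (t^-1 * k))%g; split=> //; last by rewrite -mulgA !mulVKg.
have -> : len (h^-1 * (t^-1 * k))%g = d (t * h)%g k.
  by rewrite /dist invgM mulgA.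
have thx : d (t * h)%g x = len b by rewrite /dist /x mulKg.
have := dist_4pt hL 1%g x t k; have := dist_4pt hL t x (t * h)%g k.
have := distC hL t k; have := distC hL x k; have := distC hL x (t * h)%g.
have := distC hL x t; have := distC hL (t * h)%g k; rewrite !dist1; lia.
Qed.

(** Points almost on a geodesic from [1] to a product of [n] factors are products
of [n] factors, with a larger constant. *)
Lemma products_near n C r : exists C', forall x k, products n C x ->
  (len k + d k x <= len x + r)%N -> products n C' k.
Proof.
elim: n r => [|n IH] r /=; first by exists (C + r)%N => x k; lia.
have [C1 HC1] := IH (r + D)%N.
exists (maxn C1 (maxn C (E + 2 * C + r + 3 * D))).
move=> x k [t [i [h [b [Pt Hh bC ->]]]]].
move=> /(close_to_last_factor Hh bC)[kt|[q [b' [Hq b'C ->]]]].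
  have /(products_le (leqnSn n))/products_mono := HC1 _ _ Pt kt.
  by apply; rewrite leq_maxl.
exists t, i, q, b'; split=> //; last by rewrite !leq_max b'C !orbT.
by apply: products_mono Pt; rewrite !leq_max leqnn orbT.
Qed.

Variable K : set G.
Hypothesis hK : subgroup K.
Hypothesis Kinf : forall (g : G) i, ~ finite_index K (K `&` conjugate (H i) g).

(** The elements [z] of [K] such that no coset of an [H i] is at distance at most
[C] from both [1] and [z]. *)
Let S (C : nat) : set G := [set z | K z /\
  forall i b h b', H i h -> (len b <= C)%N -> (len b' <= C)%N ->
    z <> (b * h * b')%g].

Let S_neq0 C : exists z, S C z.
Proof.
apply: contrapT => nS.
have /finite_seqP[B BE] := len_ball hL C.
have /finite_seqP[B2 B2E] := len_ball hL (C + C).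
(* [b h b'] is in the coset of [b b'] for the subgroup [b'^-1 (H i) b']. *)
pose L (p : 'I_s * G) := conjugate (H p.1) p.2^-1%g.
have [|||p _ /Kinf//] :=
  @neumann G _ K L [seq (i, b) | i <- enum 'I_s, b <- B] [set` B2] hK.
- by move=> p; apply: subgroup_conjugate.
- by apply/finite_seqP; exists B2.
move=> k Kk; apply: contrapT => nk; apply: nS; exists k.
split=> // i b h b' Hh bC b'C kE.
apply: nk; exists (i, b'), (b * b')%g; split.
- apply: allpairs_f; first by rewrite mem_enum.
  by have : [set` B] b' by rewrite -BE.
- by rewrite -B2E /=; apply: leq_trans (lenM hL _ _) _; apply: leq_add.
- by exists h => //=; rewrite kE invgK invgM -!mulgA mulKg.
Qed.

(** Whatever [u] in [K], there are escaping elements of [K] with a bounded Gromov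
product with [u]. *)
Lemma escaping_direction : exists c, forall u, K u -> forall C,
  exists2 z, S C z & (len u + len z <= d u z + c)%N.
Proof.
apply: contrapT => nc.
apply: (@no_attracting_point G len D hL K S _ _ _ S_neq0).
- exact: subgroupM.
- exact: subgroupV.
- move=> m n mn z [Kz Hz]; split=> // i b h b' Hh bm b'm.
  by apply: (Hz i) => //; apply: leq_trans mn.
- by move=> n z [].
- move=> n z [Kz Hz]; split; first exact: subgroupV.
  move=> i b h b' Hh bC b'C zE; apply: (Hz i b'^-1%g h^-1%g b^-1%g).
  + exact: subgroupV.
  + by rewrite (lenV hL).
  + by rewrite (lenV hL).
  + by rewrite -[LHS]invgK zE !invgM mulgA.
- move=> n w z Kw [Kz Hz]; split; first exact: subgroupM.
  move=> i b h b' Hh bC b'C wzE; apply: (Hz i (w^-1 * b)%g h b') => //.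
  + by apply: leq_trans (lenM hL _ _) _; rewrite (lenV hL) addnC leq_add2r.
  + exact: leq_trans (leq_addr _ _).
  + by rewrite -!mulgA [X in (_ * X)%g]mulgA -wzE mulKg.
move=> c; apply: contrapT => nC; apply: nc; exists (c + D)%N => u Ku C.
apply: contrapT => nz; apply: nC; exists C => z z' Sz Sz'.
have uz x : S C x -> (c + D + d u x < len u + len x)%N.
  by move=> Sx; rewrite ltnNge; apply/negP => ux; apply: nz; exists x => //; lia.
have := uz _ Sz; have := uz _ Sz'; have := dist_4pt hL z z' 1%g u.
rewrite !(dist1, distr1 hL) !(distC hL _ u); lia.
Qed.

(** [K] is not contained in a set of products of boundedly many factors. *)
Lemma not_sub_products n C : exists2 k, K k & ~ products n C k.
Proof.
have [c Hc] := escaping_direction.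
elim: n C => [|n IH] C.
  have [z [Kz Hz]] := S_neq0 C; exists z => // zC.
  apply: (Hz (Ordinal hs) z 1%g 1%g) => //; last by rewrite !mulg1.
    exact: subgroup1.
  by rewrite (len1 hL).
have [C1 HC1] := products_near n C (c + D).
have [k Kk kC1] := IH C1.
pose C2 := (E + 2 * C + c + 3 * D)%N.
have [z [Kz Hz] kz] := Hc _ (subgroupV hK Kk) (maxn C C2).
exists (k * z)%g; first exact: subgroupM.
move=> [t [i [h [b [Pt Hh bC kzE]]]]].
(* As [k^-1] and [z] have a bounded Gromov product, [k] is almost on a geodesic
   from [1] to [k z]. *)
have kr : (len k + d k (t * h * b)%g <= len (t * h * b)%g + c)%N.
  by rewrite -kzE; move: kz; rewrite /dist invgK mulKg (lenV hL).
have [kt|[q [b' [Hq b'C kE]]]] := close_to_last_factor Hh bC kr.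
  by apply: kC1; apply: HC1 Pt kt.
apply: (Hz i b'^-1%g (q^-1 * h)%g b).
- by apply: subgroupM => //; apply: subgroupV.
- by rewrite (lenV hL) leq_max b'C orbT.
- by rewrite leq_max bC.
- by rewrite -[LHS](mulKg k) kzE kE !invgM -!mulgA mulKg.
Qed.

End ProductsOfSubgroups.

Local Open Scope ring_scope.

(** * Word metrics and Cayley graphs *)

Section Walks.
Variables (V : Type) (E : V -> V -> Prop).

Lemma walk_cat m n x y z : walk E m x y -> walk E n y z -> walk E (m + n) x z.
Proof.
by elim=> [//|{}m {}x x' {}y xx' _ IH] /IH; apply: walk_cons xx'.
Qed.

Lemma walk_rev n x y : 
  (forall u v, E u v -> E v u) -> walk E n x y -> walk E n y x.
Proof.
move=> Esym; elim=> [z|{}n {}x x' {}y /Esym xx' _ IH]; first exact: walk_nil.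
by rewrite -addn1; apply: walk_cat IH (walk_cons xx' (walk_nil _ _)).
Qed.

Lemma walk_split m n x z :
  walk E (m + n) x z -> exists y, walk E m x y /\ walk E n y z.
Proof.
elim: m x => [|m IH] x; first by move=> w; exists x; split=> //; apply: walk_nil.
rewrite addSn => w; inversion w as [|k u y t xy wy]; subst.
by have [t [yt tz]] := IH _ wy; exists t; split=> //; apply: walk_cons yt.
Qed.

Lemma walk_vertices n x y : walk E n x y -> exists v : nat -> V,
  [/\ v 0%N = x, v n = y & forall i, (i < n)%N -> E (v i) (v i.+1)].
Proof.
elim=> [z|{}n {}x x' {}y xx' _ [v [v0 vn Ev]]]; first by exists (fun=> z).
exists (fun i => if i is i'.+1 then v i' else x); split=> //.
move=> -[|i]; first by rewrite v0.
exact: Ev.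
Qed.

Lemma vertices_walk n (v : nat -> V) i j : (i <= j <= n)%N ->
  (forall i, (i < n)%N -> E (v i) (v i.+1)) -> walk E (j - i) (v i) (v j).
Proof.
move=> /andP[ij jn] Ev; rewrite -{2}(subnKC ij).
have : (i + (j - i) <= n)%N by rewrite subnKC.
elim: (j - i)%N => [|k IH]; first by rewrite addn0 => _; apply: walk_nil.
rewrite addnS => kn; rewrite -addn1; apply: walk_cat (IH (ltnW kn)) _.
by apply: walk_cons (Ev _ kn) (walk_nil _ _).
Qed.

End Walks.

Section CayleyGraph.
Variables (R : realType) (G : groupType) (A : set G).
Hypothesis hA : finite_symmetric_generating A.
Local Notation E := (cayley_edge A).

Lemma cayley_edge_sym g h : E g h -> E h g.
Proof.
case: hA => _ AV _ [gh Agh]; split; first by move=> hg; apply: gh.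
by rewrite -AV; exists (g^-1 * h)%g => //; rewrite invgM invgK.
Qed.

Lemma walk_mull g n x y : walk E n x y -> walk E n (g * x)%g (g * y)%g.
Proof.
elim=> [z|{}n {}x x' {}y [xx' Axx'] _ IH]; first exact: walk_nil.
apply: walk_cons IH; split; first by move=> /mulgI.
by rewrite invgM -mulgA mulKg.
Qed.

Lemma cayley_connected g : exists n, walk E n 1%g g.
Proof.
case: hA => _ AV Agen.
suff /Agen H : subgroup [set g | exists n, walk E n 1%g g].
  by have : [set: G] g by []; rewrite -H // => a Aa;
     have [->|a1] := pselect (a = 1%g); [exists 0%N; apply: walk_nil|];
     exists 1%N; apply: walk_cons (walk_nil _ _); split;
     [exact: nesym|rewrite invg1 mul1g].
split; first by apply: mem_set; exists 0%N; apply: walk_nil.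
move=> x y /set_mem[m wx] /set_mem[n wy]; apply: mem_set; exists (m + n)%N.
apply: walk_cat wx _.
have /(walk_mull (x * y^-1)%g) := walk_rev cayley_edge_sym wy.
by rewrite mulgVK mulg1.
Qed.

(** [len] is the word length: [dist len x y] is the least length of a walk from
[x] to [y] in the Cayley graph. *)
Definition is_word_length (len : G -> nat) := forall x y,
  walk E (dist len x y) x y /\ forall n, walk E n x y -> (dist len x y <= n)%N.

Lemma word_length_exists : exists len, is_word_length len.
Proof.
have /choice[len Hlen] : forall g, exists m, walk E m 1%g g /\
    forall n, walk E n 1%g g -> (m <= n)%N.
  move=> g; have [n0 /asboolP wn0] := cayley_connected g.
  have [m /asboolP wm mmin] :=
    ex_minnP (ex_intro (fun n => `[< walk E n 1%g g >]) n0 wn0).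
  by exists m; split=> // n /asboolP/mmin.
exists len => x y; have [w1 w2] := Hlen (x^-1 * y)%g; split.
  by have := walk_mull x w1; rewrite mulVKg mulg1.
by move=> n /(walk_mull x^-1%g); rewrite mulVg => /w2.
Qed.

Variable len : G -> nat.
Hypothesis hlen : is_word_length len.
Local Notation d := (dist len).

Let walk_dist x y : walk E (d x y) x y := (hlen x y).1.
Let dist_le n x y : walk E n x y -> (d x y <= n)%N := (hlen x y).2 n.

Let triangle x y z : (d x z <= d x y + d y z)%N.
Proof. exact/dist_le/walk_cat. Qed.

Let dist_sym x y : d x y = d y x.
Proof.
by apply/eqP; rewrite eqn_leq !dist_le //;
  apply: (walk_rev cayley_edge_sym).
Qed.

Let dist_refl x : d x x = 0%N.
Proof. by apply/eqP; rewrite -leqn0; apply/dist_le/walk_nil. Qed.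

Let ball_finite n : finite_set [set x | (len x <= n)%N].
Proof.
have fW m : finite_set [set x | walk E m 1%g x].
  elim: m => [|m IH].
    apply: (@sub_finite_set _ _ [set 1%g]) => //= x w; inversion w; exact.
  case: hA => fA _ _.
  apply: (@sub_finite_set _ _ ((fun p => (p.1 * p.2)%g) @`
      (A `*` [set x | walk E m 1%g x]))).
    move=> x /= w; inversion w as [|k u y z [u1 Ay] wy]; subst.
    rewrite invg1 mul1g in Ay; exists (y, y^-1 * x)%g => /=; last by rewrite mulVKg.
    by split=> //=; have := walk_mull y^-1%g wy; rewrite mulVg.
  by apply/finite_image/finite_setX.
apply: (@sub_finite_set _ _ (\bigcup_(m in `I_n.+1) [set x | walk E m 1%g x])).
  move=> x /= xn; exists (len x) => //=.
  by have := walk_dist 1%g x; rewrite dist1.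
exact: bigcup_finite.
Qed.

Lemma graph_dist_eq (p q : graph_point R E) l : path_length p q l ->
  (forall l', path_length p q l' -> l <= l') -> cayley_dist p q = l.
Proof.
move=> pl lmin; apply/eqP; rewrite eq_le; apply/andP; split.
  by apply: ge_inf => //; exists l => l' /lmin.
by apply: lb_le_inf; [exists l|move=> l' /lmin].
Qed.

Lemma cayley_dist_vertex x y :
  cayley_dist (Vertex R E x) (Vertex R E y) = (d x y)%:R.
Proof.
apply: graph_dist_eq.
  right; exists x, y, 0, 0, (d x y); split; [by []|by []|exact: walk_dist|].
  by rewrite add0r addr0.
move=> l' [//|[v [w [r [s [n [[-> ->] [-> ->] wn ->]]]]]]].
by rewrite add0r addr0 ler_nat dist_le.
Qed.

Lemma word_length_hyperbolic : gromov_hyperbolic (@cayley_dist R G A) ->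
  exists D, hyperbolic_length len D.
Proof.
move=> [delta [delta0 Hd]]; exists (Num.truncn (2 * delta)).+1.
split.
- by rewrite -[1%g]invg1 -[_^-1%g]mulg1; apply: dist_refl.
- by move=> x; have := dist_sym x 1%g; rewrite /dist mulg1 invg1 mul1g.
- move=> x y; have := triangle 1%g x (x * y)%g.
  by rewrite /dist invg1 !mul1g mulKg.
- move=> x n nx; have := walk_dist 1%g x; rewrite dist1 -(subnKC nx) => w.
  have [y [/dist_le + /dist_le]] := walk_split w.
  have := triangle 1%g y x; rewrite !dist1 => *; exists y; lia.
- exact: ball_finite.
- move=> x y z w.
  have := Hd (Vertex R E x) (Vertex R E y) (Vertex R E z) (Vertex R E w).
  have D2 : 2 * delta <= (Num.truncn (2 * delta)).+1%:R by apply/ltW/truncnS_gt.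
  move: D2; set D := (Num.truncn _).+1; rewrite /gromov_product !cayley_dist_vertex.
  rewrite (dist_sym z y) => D2 H4.
  rewrite -(ler_nat R) natrD (natrD _ (maxn _ _)).
  have : ((d x z + d y w)%:R <= (maxn (d x z + d y w) (d x w + d y z))%:R :> R).
    by rewrite ler_nat leq_maxl.
  have : ((d x w + d y z)%:R <= (maxn (d x z + d y w) (d x w + d y z))%:R :> R).
    by rewrite ler_nat leq_maxr.
  rewrite !natrD; move: H4; rewrite /Num.min; case: ifP => _; lra.
Qed.

(** * Geodesics of the Cayley graph *)

Section VertexGeodesic.
Variables (v : nat -> G) (L : nat).
(** [v 0, ..., v L] are the vertices of a geodesic. *)
Hypothesis Ev : forall i, (i < L)%N -> E (v i) (v i.+1).
Hypothesis vL : d (v 0%N) (v L) = L.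

Let vdist i j : (i <= j <= L)%N -> d (v i) (v j) = (j - i)%N.
Proof.
move=> ijL; have /andP[ij jL] := ijL.
have h1 := dist_le (vertices_walk ijL Ev).
have h2 : (d (v 0%N) (v i) <= i - 0)%N.
  by apply/dist_le/(vertices_walk _ Ev); rewrite /= (leq_trans ij).
have h3 : (d (v j) (v L) <= L - j)%N.
  by apply/dist_le/(vertices_walk _ Ev); rewrite jL leqnn.
have := triangle (v 0%N) (v i) (v L); have := triangle (v i) (v j) (v L); lia.
Qed.

Let vinj i j : (i <= L)%N -> (j <= L)%N -> v i = v j -> i = j.
Proof.
move=> iL jL vij; have [ij|ji] := leqP i j.
  by have := @vdist i j; rewrite vij dist_refl ij jL => /(_ isT); lia.
by have := @vdist j i; rewrite vij dist_refl (ltnW ji) iL => /(_ isT); lia.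
Qed.

(** [p] is the point at time [t] of the geodesic through the vertices [v i]; a
vertex may be given as such or as an end of an edge. *)
Definition at_time (p : graph_point R E) (t : R) :=
  (exists2 i, (i <= L)%N & p = Vertex R E (v i) /\ t = i%:R) \/
  (exists i (e : E (v i) (v i.+1)) (t' : R) (ht : 0 <= t' <= 1),
     [/\ (i < L)%N, p = EdgePt e ht & t = i%:R + t' :> R]).

Let at_time_exists t : 0 <= t <= L%:R -> exists p, at_time p t.
Proof.
move=> /andP[t0 tL]; have /andP[it ti] := truncn_itv t0.
have [iL|Li] := ltnP (Num.truncn t) L; last first.
  exists (Vertex R E (v L)); left; exists L => //; split=> //.
  by apply/eqP; rewrite eq_le tL; apply: le_trans it; rewrite ler_nat.
have ht : 0 <= t - (Num.truncn t)%:R <= 1.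
  by rewrite -natr1 in ti; lra.
exists (EdgePt (Ev iL) ht); right.
exists (Num.truncn t), (Ev iL), (t - (Num.truncn t)%:R), ht.
by split=> //; rewrite addrC subrK.
Qed.

Let at_time_end p t w r : at_time p t -> end_segment p w r ->
  exists2 a, (a <= L)%N & w = v a /\ r = `|t - a%:R|.
Proof.
move=> [[i iL [-> ->]]|[i [e [t' [ht [iL -> ->]]]]]] /=.
  by move=> [-> ->]; exists i => //; rewrite subrr normr0.
case/andP: ht => t0 t1.
move=> [[-> ->]|[-> ->]]; [exists i|exists i.+1] => //; rewrite ?(ltnW iL) //.
  by rewrite addrC addKr ger0_norm.
split=> //; rewrite ler0_norm -natr1; lra.
Qed.

(** A point at time [t] is on a segment, reduced to a vertex or equal to an edge,
from the vertex at time [i <= t] to the vertex at time [j >= t]. *)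
Let at_time_bracket p t : at_time p t -> exists i j,
  [/\ (i <= j <= L)%N, i%:R <= t <= j%:R,
   end_segment p (v i) (t - i%:R), end_segment p (v j) (j%:R - t) &
   i = j \/ j = i.+1 /\
     exists (e : E (v i) (v i.+1)) ht,
       p = @EdgePt _ _ _ (v i) (v i.+1) e (t - i%:R) ht].
Proof.
move=> [[i iL [-> ->]]|[i [e [t' [ht [iL -> ->]]]]]].
  by exists i, i; rewrite subrr leqnn iL lexx; split=> //; left.
case/andP: (ht) => t0 t1.
exists i, i.+1; rewrite (addrC i%:R t') addrK leqnSn iL; split=> //=.
- by rewrite -natr1; lra.
- by left.
- by right; split=> //; rewrite -natr1; ring.
- by right; split=> //; exists e, ht.
Qed.

Let at_time_dist p q s t :
  at_time p s -> at_time q t -> cayley_dist p q = `|s - t|.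
Proof.
move=> ps qt; apply: graph_dist_eq; last first.
  move=> l [|[x [y [r [r' [n [px qy w ->]]]]]]]; last first.
    have [a aL [xE ->]] := at_time_end ps px.
    have [b bL [yE ->]] := at_time_end qt qy.
    have : `|a%:R - b%:R| <= n%:R :> R.
      have := dist_le w; rewrite xE yE.
      have [ab|ba] := leqP a b.
        rewrite vdist ?ab // distrC -natrB // normr_nat ler_nat //.
      rewrite dist_sym vdist ?(ltnW ba) // -natrB ?(ltnW ba) // normr_nat ler_nat //.
    have := ler_distD a%:R s t; have := ler_distD b%:R a%:R t.
    by rewrite (distrC b%:R t); lra.
  case: ps qt => [[i iL [-> ->]]//|[i [e [t1 [ht1 [iL -> ->]]]]]].
  case=> [[j jL [-> ->]]//|[j [e' [t2 [ht2 [jL -> ->]]]]]] /=.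
  case=> [[/vinj vj _ ->]|[/vinj vj /vinj vj' _]].
    by rewrite vj ?(ltnW iL) ?(ltnW jL) // opprD addrACA subrr add0r.
  by exfalso; have := vj (ltnW jL) iL; have := vj' jL (ltnW iL); lia.
have [i [j [/andP[ij jL] /andP[si sj] pi pj ijE]]] := at_time_bracket ps.
have [i' [j' [/andP[ij' jL'] /andP[ti tj] qi qj ijE']]] := at_time_bracket qt.
have [ji'|i'j] := leqP j i'.
  have st : j%:R <= i'%:R :> R by rewrite ler_nat.
  right; exists (v j), (v i'), (j%:R - s), (t - i'%:R), (i' - j)%N.
  split=> //; first by apply: vertices_walk Ev; rewrite ji' (leq_trans ij').
  by rewrite natrB // ler0_norm; lra.
have [j'i|ij''] := leqP j' i.
  have st : j'%:R <= i%:R :> R by rewrite ler_nat.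
  right; exists (v i), (v j'), (s - i%:R), (j'%:R - t), (i - j')%N.
  split=> //; first apply: (walk_rev cayley_edge_sym).
    by apply: vertices_walk Ev; rewrite j'i (leq_trans ij).
  by rewrite natrB // ger0_norm; lra.
left; case: ijE => [ijE|[jE [e [ht ->]]]]; first by case: ijE' => [|[]]; lia.
case: ijE' => [|[jE' [e' [ht' ->]]]]; first lia.
have ii' : i' = i by lia.
by left; rewrite ii'; split=> //; congr (`|_|); ring.
Qed.

Lemma vertex_geodesic_path : exists p : R -> graph_point R E,
  is_geodesic (@cayley_dist R G A)
    (Vertex R E (v 0%N)) (Vertex R E (v L)) L%:R p /\
  forall a, (a <= L)%N -> at_time (p a%:R) a%:R.
Proof.
have /choice[p Hp] : forall t : R, exists q, 0 <= t <= L%:R -> at_time q t.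
  move=> t; have [/at_time_exists[q]|nt] := boolP (0 <= t <= L%:R).
    by exists q.
  by exists (Vertex R E 1%g).
have L0 : 0 <= L%:R :> R by [].
exists p; split; last by move=> a aL; apply: Hp; rewrite ler_nat aL ler0n.
split=> //.
- rewrite (@at_time_dist _ _ 0 0%:R) ?subrr ?normr0 //; last by left; exists 0%N.
  by apply: Hp; rewrite lexx L0.
- rewrite (@at_time_dist _ _ L%:R L%:R) ?subrr ?normr0 //; last by left; exists L.
  by apply: Hp; rewrite lexx L0.
- by move=> s t sL tL; apply: at_time_dist; apply: Hp.
Qed.

(** The infimum defining the distance to [z] is only approached up to [1], which
makes no difference to quasiconvexity. *)
Lemma near_at_time p a z (eps : R) : (a <= L)%N -> at_time p a%:R ->
  cayley_dist p (Vertex R E z) <= eps -> (d (v a) z)%:R < eps + 1.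
Proof.
move=> aL pa dle.
have [i [j [_ _ pi _ _]]] := at_time_bracket pa.
have [l pl llt] : exists2 l, path_length p (Vertex R E z) l & l < eps + 1.
  apply: inf_lt; last by apply: le_lt_trans dle _; rewrite ltrDl.
  eexists; right; exists (v i), z, (a%:R - i%:R), 0, (d (v i) z).
  by split=> //; exact: walk_dist.
have [pF|[x [y [r [r' [n [px [yE r'E] w lE]]]]]]] := pl.
  by move: pF; case: (p).
rewrite lE r'E addr0 in llt; rewrite yE in w.
have [c cL [xE rE]] := at_time_end pa px.
apply: le_lt_trans llt; rewrite rE.
have dn := dist_le w; rewrite xE in dn.
have [ac|ca] := leqP a c.
  rewrite distrC -natrB // normr_nat -natrD ler_nat.
  by have := triangle (v a) (v c) z; rewrite vdist ?ac //; lia.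
rewrite -natrB ?(ltnW ca) // normr_nat -natrD ler_nat.
have := triangle (v a) (v c) z.
by rewrite (dist_sym (v a) (v c)) vdist ?(ltnW ca) //; lia.
Qed.

End VertexGeodesic.

(** A vertex between two elements of a quasiconvex [Q] for the word metric is on
a geodesic of the Cayley graph joining them. *)
Lemma quasiconvex_vertices Q : quasiconvex R A Q -> exists C, forall x y u,
  Q x -> Q y -> (d x u + d u y = d x y)%N -> exists2 q, Q q & (d u q <= C)%N.
Proof.
move=> [eps eps0 qcQ]; exists (Num.truncn (eps + 1)).+1 => x y u Qx Qy xuy.
have [v1 [v10 v1u Ev1]] := walk_vertices (walk_dist x u).
have [v2 [v20 v2y Ev2]] := walk_vertices (walk_dist u y).
(* Concatenation of geodesics from [x] to [u] and from [u] to [y]. *)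
pose v i := if (i <= d x u)%N then v1 i else v2 (i - d x u)%N.
have vu : v (d x u) = u by rewrite /v leqnn.
have v0 : v 0%N = x by [].
have vy : v (d x y) = y.
  rewrite /v -xuy addKn; case: leqP => // uy.
  have uy0 : d u y = 0%N by lia.
  by rewrite uy0 addn0 v1u -v20 -[RHS]v2y uy0.
have Ev i : (i < d x y)%N -> E (v i) (v i.+1).
  move=> iL; rewrite /v; case: (ltngtP i (d x u)) => [ixu|xui|ixu].
  - exact: Ev1.
  - by rewrite subSn ?(ltnW xui) //; apply: Ev2; lia.
  - by rewrite ixu subSn // subnn v1u -v20; apply: Ev2; lia.
have vL : d (v 0%N) (v (d x y)) = d x y by rewrite v0 vy.
have [p [pg pt]] := vertex_geodesic_path Ev vL.
have uL : (d x u <= d x y)%N by lia.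
rewrite v0 vy in pg.
have [|z Qz pz] := qcQ x y (d x y)%:R p Qx Qy pg (d x u)%:R.
  by rewrite ler0n ler_nat.
exists z => //; rewrite -(ler_nat R) -vu ltW //.
by apply: lt_trans (near_at_time Ev vL uL (pt _ uL) pz) _; apply: truncnS_gt.
Qed.

End CayleyGraph.

(** * Finite unions of quasiconvex products *)

Lemma products_prod (G : groupType) (len : G -> nat) (s : nat)
    (H : 'I_s -> set G) (C n : nat) (c : G) (f : 'I_n -> G) :
  (len c <= C)%N ->
  (forall i, exists j h b, [/\ H j h, (len b <= C)%N & f i = (h * b)%g]) ->
  products len H n C (c * \prod_(i < n) f i)%g.
Proof.
elim: n f => [|n IH] f cC Hf; first by rewrite big_ord0 mulg1.
have [j [h [b [Hh bC fE]]]] := Hf ord_max.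
rewrite big_ord_recr /= mulgA fE mulgA; eexists; exists j, h, b; split=> //.
exact: IH.
Qed.

Lemma product_set_products (G : groupType) (len : G -> nat) (s : nat)
    (H : 'I_s -> set G) (P : product_data G) (C : nat) :
  (forall i, exists j, H j = Defs.factor P i) ->
  (forall i, (len (Defs.coef P i) <= C)%N) ->
  product_set P `<=` products len H (nfactors P) C.
Proof.
move=> PH PC _ [g Pg <-]; apply: products_prod => // i.
have [j Hj] := PH i; exists j, (g i), (Defs.coef P (lift ord0 i)).
by split=> //; rewrite Hj; apply: Pg.
Qed.

Theorem theorem2 (R : realType) (G : groupType) (A : set G)
    (hG : hyperbolic_wrt R A)
    (q : nat) (P : 'I_q -> product_data G)
    (hP : forall k : 'I_q, quasiconvex_product R A (P k))
    (s : nat) (hs : (1 <= s)%N) (H : 'I_s -> set G)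
    (hH : range H = \bigcup_(k in [set: 'I_q]) members (P k))
    (K : set G) (hK : subgroup K)
    (hKU : K `<=` \bigcup_(k in [set: 'I_q]) product_set (P k)) :
  exists (g : G) (j : 'I_s), finite_index K (K `&` conjugate (H j) g).
Proof.
have [hA hyp] := hG.
have [len hlen] := word_length_exists hA.
have [D hL] := word_length_hyperbolic hA hlen hyp.
have Hmem j : exists k i, Defs.factor (P k) i = H j.
  have : range H (H j) by exists j.
  by rewrite hH => -[k _ [i _ ?]]; exists k, i.
have Hsub j : subgroup (H j).
  by have [k [i <-]] := Hmem j; have [] := hP k i.
have /choice[C HC] : forall j, exists C, forall x y u, H j x -> H j y ->
    (dist len x u + dist len u y = dist len x y)%N ->
    exists2 z, H j z & (dist len u z <= C)%N.
  move=> j; have [k [i <-]] := Hmem j; have [_] := hP k i.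
  exact: (quasiconvex_vertices hA hlen).
apply: contrapT => nfi.
pose n := (\max_(k < q) nfactors (P k))%N.
pose B :=
  (\max_(k < q) \max_(i < (nfactors (P k)).+1) len (Defs.coef (P k) i))%N.
have [||k Kk] := @not_sub_products G len D hL s H (\max_(j < s) C j)%N hs Hsub
  _ K hK _ n B.
- move=> j x y u Hx Hy xuy; have [z Hz uz] := HC j x y u Hx Hy xuy.
  by exists z => //; apply: leq_trans uz (leq_bigmax j).
- by move=> g j fi; apply: nfi; exists g, j.
apply; have [m _ Pmk] := hKU k Kk.
apply: (products_le hL hs Hsub (leq_bigmax m)).
apply: product_set_products Pmk => i.
  have : (\bigcup_(k in [set: 'I_q]) members (P k)) (Defs.factor (P m) i).
    by exists m => //; exists i.
  by rewrite -hH => -[j _ <-]; exists j.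
apply: leq_trans (leq_bigmax m); exact: (leq_bigmax i).
Qed.
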